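(* Assume that $F(x,z)\in\mathbb{F}_p(z)[x]_{\le Mn}$ is such that $$\frac{\partial F}{\partial x}(x,z)=\sum_{j=1}^nA_j(z)\frac{\Phi(x,z)}{x-z_j}$$ for some $A_1(z),\dots,A_n(z)\in\mathbb{F}_p(z)$. Then there exist unique $D_0(z),D_1(z),\dots,D_n(z)\in\mathbb{F}_p(z)$ such that $$F(x,z)=D_0(z)\Phi(x,z)+\sum_{j=1}^nD_j(z)Q_j(x,z).$$
   Context: Let $p,q$ be prime numbers, $k$ a positive integer, $n=kq+1$, and $p>n$. Let $z=(z_1,\dots,z_n)$, and let $\mathbb{F}_p(z)=\mathbb{F}_p(z_1,\dots,z_n)$ be the field of rational functions. Let $a$ be the unique integer with $1\le a<q$ and $q\mid(ap-1)$; put $M=(ap-1)/q\in\mathbb{Z}_{>0}$. Let $\Phi(x,z)=\prod_{i=1}^n(x-z_i)^M$ over $\mathbb{F}_p$. $\mathbb{F}_p(z)[x]_{\le m}$ is the $\mathbb{F}_p(z)$-vector space of polynomials in $x$ of degree at most $m$ with coefficients in $\mathbb{F}_p(z)$. The space $\Omega_{\log}$ is the $\mathbb{F}_p(z)$-span of the polynomials $\frac{\Phi(x,z)}{x-z_j}$, $j=1,\dots,n$. For $i=1,\dots,n$, $Q_i(x,z)\in\mathbb{F}_p(z)[x]$ is the polynomial $$Q_i(x,z)=\frac{\Phi(x,z)}{(x-z_i)^M}+\sum_{m=1}^{M-1}A_{i,m}(z)\frac{\Phi(x,z)}{(x-z_i)^m},$$ where $A_{i,1}(z),\dots,A_{i,M-1}(z)\in\mathbb{F}_p(z)$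 are the coefficients (they exist and are unique) for which $\frac{\partial Q_i}{\partial x}\in\Omega_{\log}$. *)

(* Defs.v *)
From HB Require Import structures.
From mathcomp Require Import all_boot all_order all_algebra.
From mathcomp Require Import mpoly.

Set Implicit Arguments.
Unset Strict Implicit.
Unset Printing Implicit Defensive.

Import GRing.Theory.
Local Open Scope ring_scope.

(* Only meaningful for p prime: 'F_p is the field with pdiv p elements. *)
Definition ratfun (p n : nat) : fieldType := {fraction {mpoly 'F_p[n]}}.

Definition zvar (p n : nat) (i : 'I_n) : ratfun p n :=
  FracField.tofrac ('X_i : {mpoly 'F_p[n]}).

Definition Xsubz (p n : nat) (i : 'I_n) : {poly ratfun p n} :=
  'X - (zvar p i)%:P.

Definition Phi (p n M : nat) : {poly ratfun p n} :=
  \prod_(i < n) Xsubz p i ^+ M.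

(* Phi / (x - z_i)^m: for m <= M the Euclidean quotient is exact. *)
Definition Phi_over (p n M : nat) (i : 'I_n) (m : nat) : {poly ratfun p n} :=
  Phi p n M %/ Xsubz p i ^+ m.

Definition in_Omega_log (p n M : nat) (g : {poly ratfun p n}) : Prop :=
  exists A : 'I_n -> ratfun p n, g = \sum_(j < n) A j *: Phi_over p M j 1.

(* Only the coefficients A i m with 1 <= m <= M - 1 occur. *)
Definition Q (p n M : nat) (A : 'I_n -> nat -> ratfun p n) (i : 'I_n) :
    {poly ratfun p n} :=
  Phi_over p M i M + \sum_(1 <= m < M) A i m *: Phi_over p M i m.

(* Main.v *)
Require Import Defs.
From HB Require Import structures.
From mathcomp Require Import all_boot all_order all_algebra.
From mathcomp Require Import mpoly.

Set Implicit Arguments.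
Unset Strict Implicit.
Unset Printing Implicit Defensive.

Import GRing.Theory.
Local Open Scope ring_scope.

(* Phi vanishes at every z_j, while Q_i vanishes at z_j exactly when j <> i. So
   D_j = F(z_j) / Q_j(z_j) is forced, and D_0 is then unique.
   Conversely G = F - sum_j D_j Q_j vanishes at every z_j, and its derivative,
   being in Omega_log, is divisible by (x - z_j)^(M-1). As M < p, integrating
   raises the order of vanishing, so (x - z_j)^M divides G for all j; hence Phi
   divides G, and deg G <= Mn = deg Phi makes G a multiple of Phi. *)

(** Induction on [m]: once G = H (x-c)^(m+1), the derivative is H' (x-c)^(m+1) + (m+1) H (x-c)^m.
    Divisibility by (x-c)^(m+1) then forces x-c to divide (m+1) H, hence H, because m+1 is
    invertible. *)
Lemma dvdp_XsubC_exp_deriv (K : fieldType) (c : K) (m : nat) (G : {poly K}) :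
    (forall j, (0 < j <= m)%N -> j%:R != 0 :> K) ->
    root G c -> ('X - c%:P) ^+ m %| G^`() ->
  ('X - c%:P) ^+ m.+1 %| G.
Proof.
move=> char_m Gc; elim: m char_m => [|m IHm] char_m dvdG'.
  by rewrite expr1 dvdp_XsubCl.
have /IHm : forall j, (0 < j <= m)%N -> j%:R != 0 :> K.
  by move=> j /andP[j_gt0 le_jm]; rewrite char_m // j_gt0 leqW.
case/(_ (dvdp_trans (dvdp_exp2l _ (leqnSn m)) dvdG'))/dvdpP=> H defG.
move: dvdG'; rewrite defG derivM deriv_exp derivXsubC mul1r /=.
rewrite dvdp_addr ?dvdp_mulIr // -mulr_natr mulrA mulrAC => dvdH.
rewrite (exprS _ m.+1) dvdp_mul2r ?expf_neq0 ?polyXsubC_eq0 //.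
move: dvdH; rewrite exprS dvdp_mul2r ?expf_neq0 ?polyXsubC_eq0 //.
by rewrite mulrC -polyC_natr mul_polyC dvdpZr ?char_m ?leqnn.
Qed.

(** Gauss's lemma, one factor at a time; [uniq r] makes the head index differ from all later ones,
    so its factor is coprime to their product. *)
Lemma dvdp_prod_coprime (K : fieldType) (I : eqType) (r : seq I)
    (f : I -> {poly K}) (G : {poly K}) :
    uniq r -> (forall i j, i != j -> coprimep (f i) (f j)) ->
    (forall i, f i %| G) ->
  \prod_(i <- r) f i %| G.
Proof.
move=> uniq_r cop_f dvd_f; elim: r uniq_r => [|i r IHr] /=.
  by rewrite big_nil dvd1p.
case/andP=> r_i /IHr dvd_r; rewrite big_cons Gauss_dvdp ?dvd_f //.
rewrite big_seq; elim/big_ind: _ => [|P1 P2 cop1 cop2|j r_j].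
- exact: coprimep1.
- by rewrite coprimepMr cop1.
- by apply: cop_f; apply: contraNneq r_i => ->.
Qed.

Lemma natr_ratfun_neq0 (p n j : nat) :
  prime p -> (0 < j < p)%N -> j%:R != 0 :> ratfun p n.
Proof.
move=> p_pr /andP[j_gt0 lt_jp].
have charP : p \in [pchar {mpoly 'F_p[n]}].
  exact: (rmorph_pchar (@mpolyC n 'F_p : {rmorphism _ -> _}) (pchar_Fp p_pr)).
have charQ : p \in [pchar ratfun p n].
  exact: (rmorph_pchar
    (@FracField.tofrac {mpoly 'F_p[n]} : {rmorphism _ -> _}) charP).
by rewrite -(dvdn_pcharf charQ) gtnNdvd.
Qed.

Lemma zvar_inj (p n : nat) : injective (@zvar p n).
Proof.
move=> i j /eqP; rewrite /zvar tofrac_eq => /eqP eqX.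
have := congr1 (mcoeff U_(i)%MM) eqX; rewrite !mcoeffXU eqxx.
by case: eqP => [//|_] /eqP; rewrite oner_eq0.
Qed.

Section MasterPolynomial.

Variables p n M : nat.

Lemma Xsubz_neq0 (i : 'I_n) : Xsubz p i != 0.
Proof. by rewrite polyXsubC_eq0. Qed.

Lemma horner_Xsubz_exp (i : 'I_n) (m : nat) (x : ratfun p n) :
  (Xsubz p i ^+ m).[x] = (x - zvar p i) ^+ m.
Proof. by rewrite horner_exp hornerXsubC. Qed.

Lemma Phi_neq0 : Phi p n M != 0.
Proof. by apply/prodf_neq0 => i _; rewrite expf_neq0 ?Xsubz_neq0. Qed.

Lemma size_Phi : size (Phi p n M) = (M * n).+1.
Proof.
rewrite size_prod => [|i _]; last by rewrite expf_neq0 ?Xsubz_neq0.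
under eq_bigr do rewrite size_exp_XsubC.
by rewrite sum_nat_const card_ord mulnS -addnS addKn mulnC.
Qed.

Lemma Phi_overE (i : 'I_n) (m : nat) : (m <= M)%N ->
  Phi_over p M i m = Xsubz p i ^+ (M - m) * \prod_(j | j != i) Xsubz p j ^+ M.
Proof.
move=> le_mM; rewrite /Phi_over.
have -> : Phi p n M =
    Xsubz p i ^+ (M - m) * (\prod_(j | j != i) Xsubz p j ^+ M) * Xsubz p i ^+ m.
  by rewrite mulrAC -exprD subnK // /Phi (bigD1 i).
by rewrite mulpK // expf_neq0 ?Xsubz_neq0.
Qed.

Lemma Phi_over_top (i : 'I_n) :
  Phi_over p M i M = \prod_(j | j != i) Xsubz p j ^+ M.
Proof.
by rewrite /Phi_over /Phi (bigD1 i) //= mulKp // expf_neq0 ?Xsubz_neq0.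
Qed.

Hypothesis M_gt0 : (0 < M)%N.

Lemma root_Phi (i : 'I_n) : (Phi p n M).[zvar p i] = 0.
Proof.
by rewrite /Phi (bigD1 i) //= hornerM horner_Xsubz_exp subrr expr0n
  gtn_eqF // mul0r.
Qed.

(** The factor x - z_j survives in the quotient with exponent M if j <> i and M - m if j = i; the
    disjunction makes this exponent positive. *)
Lemma root_Phi_over (i j : 'I_n) (m : nat) :
  (m <= M)%N -> (i != j) || (m < M)%N -> (Phi_over p M i m).[zvar p j] = 0.
Proof.
move=> le_mM; rewrite Phi_overE // hornerM; case: eqVneq => [<-|ne_ij] /= lt_mM.
  by rewrite horner_Xsubz_exp subrr expr0n subn_eq0 leqNgt lt_mM mul0r.
have ne_ji : j != i by rewrite eq_sym.
rewrite (bigD1 j) //= hornerM [X in _ * (X * _)]horner_Xsubz_exp subrr expr0n.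
by rewrite gtn_eqF // mul0r mulr0.
Qed.

Lemma root_Q (A : 'I_n -> nat -> ratfun p n) (i j : 'I_n) :
  i != j -> (Q M A i).[zvar p j] = 0.
Proof.
move=> ne_ij; rewrite /Q hornerD root_Phi_over ?ne_ij // add0r big_nat.
rewrite horner_sum big1 // => m /andP[_ lt_mM].
by rewrite hornerZ root_Phi_over ?ne_ij ?mulr0 // ltnW.
Qed.

(** Only the leading term of Q_i is free of the factor x - z_i, so the value is the product over j
    <> i of (z_i - z_j)^M, whatever [A] is. *)
Lemma horner_Q_neq0 (A : 'I_n -> nat -> ratfun p n) (i : 'I_n) :
  (Q M A i).[zvar p i] != 0.
Proof.
rewrite /Q hornerD big_nat horner_sum [X in _ + X]big1 => [|m /andP[_ lt_mM]].
  rewrite addr0 Phi_over_top horner_prod.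
  apply/prodf_neq0 => j ne_ji; rewrite horner_Xsubz_exp expf_neq0 //.
  by rewrite subr_eq0 (inj_eq (@zvar_inj p n)) eq_sym.
by rewrite hornerZ root_Phi_over ?mulr0 ?lt_mM ?orbT // ltnW.
Qed.

Lemma size_Phi_over (i : 'I_n) (m : nat) :
  (size (Phi_over p M i m) <= (M * n).+1)%N.
Proof. by rewrite -size_Phi leq_divp. Qed.

Lemma size_Q (A : 'I_n -> nat -> ratfun p n) (i : 'I_n) :
  (size (Q M A i) <= (M * n).+1)%N.
Proof.
rewrite (leq_trans (size_polyD _ _)) // geq_max size_Phi_over /=.
apply: (leq_trans (size_sum _ _ _)); apply/bigmax_leqP_seq => m _ _.
exact: leq_trans (size_scale_leq _ _) (size_Phi_over _ _).
Qed.

(** Dividing Phi by x - z_j removes at most one of its M factors x - z_i, and does so only for j =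
    i. *)
Lemma Omega_log_dvdp (g : {poly ratfun p n}) (i : 'I_n) :
  in_Omega_log M g -> Xsubz p i ^+ M.-1 %| g.
Proof.
case=> B ->; elim/big_rec: _ => [|j g' _ dvd_g']; first exact: dvdp0.
rewrite dvdp_add // -mul_polyC dvdp_mull // Phi_overE // subn1.
have [<-|ne_ij] := eqVneq i j; first exact: dvdp_mulr.
by rewrite dvdp_mull // (bigD1 i) //= dvdp_mulr // dvdp_exp2l ?leq_pred.
Qed.

(** Membership of [h i] only asserts that coefficients exist; removing one summand at a time unpacks
    them without choosing a family over all [i]. *)
Lemma in_Omega_logB_lincomb (g : {poly ratfun p n})
    (h : 'I_n -> {poly ratfun p n}) (D : 'I_n -> ratfun p n) :
    in_Omega_log M g -> (forall i, in_Omega_log M (h i)) ->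
  in_Omega_log M (g - \sum_(i < n) D i *: h i).
Proof.
move=> Og Oh; elim/big_rec: _ => [|i s _ [B defB]]; first by rewrite subr0.
have [C defC] := Oh i; exists (fun j => B j - D i * C j).
rewrite opprD addrCA defB defC addrC scaler_sumr -sumrB.
by apply: eq_bigr => j _; rewrite scalerA scalerBl.
Qed.

Lemma eq_scale_Phi (G : {poly ratfun p n}) :
    prime p -> (M <= p)%N -> (size G <= (M * n).+1)%N ->
    in_Omega_log M G^`() -> (forall i, G.[zvar p i] = 0) ->
  exists c, G = c *: Phi p n M.
Proof.
move=> p_pr le_Mp szG OG' Gz.
have dvdG : Phi p n M %| G.
  apply: dvdp_prod_coprime => [||i]; first exact: index_enum_uniq.
    move=> i j ne_ij; rewrite coprimep_expl ?coprimep_expr // coprimep_XsubC2 //.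
    by rewrite subr_eq0 (inj_eq (@zvar_inj p n)) eq_sym.
  (* Integrating from order M-1 to M inverts only 1, ..., M-1, which are nonzero modulo p as soon as
     M <= p. *)
  rewrite -(prednK M_gt0) dvdp_XsubC_exp_deriv ?Omega_log_dvdp //.
    move=> j /andP[j_gt0 le_jM]; apply: natr_ratfun_neq0; rewrite // j_gt0.
    by rewrite (leq_trans _ le_Mp) // -(prednK M_gt0).
  exact/rootP/Gz.
case/dvdpP: dvdG szG => H ->.
have [-> _|H_neq0] := eqVneq H 0; first by exists 0; rewrite mul0r scale0r.
rewrite size_mul ?Phi_neq0 // size_Phi addnS /= -[leqRHS]add1n leq_add2r.
by move/size1_polyC=> ->; exists H`_0; rewrite mul_polyC.
Qed.

End MasterPolynomial.

Theorem theorem4p4 (p q k n a M : nat)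
  (p_prime : prime p) (q_prime : prime q) (k_gt0 : (0 < k)%N)
  (n_def : n = (k * q + 1)%N) (p_gt_n : (n < p)%N)
  (a_bounds : (1 <= a < q)%N) (a_dvd : (q %| a * p - 1)%N)
  (M_def : M = ((a * p - 1) %/ q)%N)
  (A : 'I_n -> nat -> ratfun p n)
  (A_def : forall i : 'I_n, in_Omega_log M (Q M A i)^`())
  (F : {poly ratfun p n}) (F_deg : (size F <= (M * n).+1)%N)
  (F_deriv : exists B : 'I_n -> ratfun p n,
     F^`() = \sum_(j < n) B j *: Phi_over p M j 1) :
  exists! D : ratfun p n * {ffun 'I_n -> ratfun p n},
    F = D.1 *: Phi p n M + \sum_(j < n) D.2 j *: Q M A j.
Proof.
have qM : (M * q = a * p - 1)%N by rewrite M_def divnK.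
have q_gt0 := prime_gt0 q_prime.
have M_gt0 : (0 < M)%N.
  (* M = 0 would give ap <= 1, against a >= 1 and p >= 2. *)
  rewrite lt0n; apply/eqP => M0; move: qM; rewrite M0 mul0n => /esym/eqP.
  rewrite subn_eq0 leqNgt (leq_trans (prime_gt1 p_prime)) //.
  by rewrite leq_pmull //; case/andP: a_bounds.
have le_Mp : (M <= p)%N.
  (* Since a < q, Mq = ap - 1 <= pq. *)
  rewrite -(leq_pmul2r q_gt0) qM leq_subLR addnC mulnC.
  by rewrite (leq_trans _ (leq_addr _ _)) // leq_mul2l
    (ltnW (andP a_bounds).2) orbT.
(* Evaluation at the z_i is diagonal on the Q_j; this serves both existence and uniqueness. *)
have eval (D : ratfun p n * {ffun 'I_n -> ratfun p n}) i :
    (D.1 *: Phi p n M + \sum_(j < n) D.2 j *: Q M A j).[zvar p i] =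
    D.2 i * (Q M A i).[zvar p i].
  rewrite hornerD hornerZ root_Phi // mulr0 add0r horner_sum (bigD1 i) //=.
  rewrite [X in _ + X]big1 => [|j ne_ji]; last by rewrite hornerZ root_Q // mulr0.
  by rewrite hornerZ addr0.
pose D := [ffun i => F.[zvar p i] / (Q M A i).[zvar p i]].
have [|||c defF] :=
    @eq_scale_Phi p n M M_gt0 (F - \sum_(j < n) D j *: Q M A j) p_prime le_Mp.
- rewrite (leq_trans (size_polyD _ _)) // size_polyN geq_max F_deg /=.
  apply: leq_trans (size_sum _ _ _) _; apply/bigmax_leqP => j _.
  by rewrite (leq_trans (size_scale_leq _ _)) // size_Q.
- rewrite derivB raddf_sum /=; under eq_bigr do rewrite derivZ.
  exact: in_Omega_logB_lincomb.
(* A zero coefficient on Phi turns [eval] into the value of the bare sum of the D_j Q_j. *)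
- move=> i; have := eval (0, D) i; rewrite /= scale0r add0r hornerD hornerN => ->.
  by rewrite ffunE divfK ?subrr ?horner_Q_neq0.
have defD : F = c *: Phi p n M + \sum_(j < n) D j *: Q M A j.
  by rewrite -defF subrK.
exists (c, D); split=> // -[c' D'] /= defD'.
have eqD : D = D'.
  apply/ffunP => i; apply: (mulIf (horner_Q_neq0 M_gt0 A i)).
  by rewrite -(eval (c, D)) -(eval (c', D')) -defD' -defD.
congr (_, _) => //; apply/eqP; rewrite -subr_eq0.
(* With the D_j equal, the two expansions of F differ only by a multiple of the nonzero polynomial
   Phi. *)
have /eqP : (c - c') *: Phi p n M = 0.
  rewrite scalerBl; apply/eqP; rewrite subr_eq0.
  rewrite -(inj_eq (addIr (\sum_(j < n) D j *: Q M A j))).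
  by rewrite -defD eqD -defD'.
by rewrite scaler_eq0 (negPf (Phi_neq0 _ _ _)) orbF.
Qed.
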